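(* Let $X$ be a set of alternatives, let $T=\{\langle \mathsf{C}_i,n_i,m_i\rangle\}_{i\in I}$ be a representation such that $TX$ admits a $T$-representation map, and let $\mathcal V\subseteq TX$ be expressive and $T$-closed. If a decision procedure $P\colon TX\to X$ is $\mathcal V$-EXT and $\mathcal V$-IND, then $P$ is $\mathcal V$-rationalizable.
   Context: $X$ is a set of alternatives, and $2^X$ denotes the set of non-empty finite subsets of $X$ (the ''decision problems''). Representations. $T=\{\langle \mathsf{C}_i,n_i,m_i\rangle\}_{i\in I}$ is a finite set of triples, where the $\mathsf{C}_i$ are pairwise distinct names (constructors) and $n_i,m_i\ge 0$ are natural numbers; at least one constructor has $n_i>0$ and $m_i=0$. $TX$ is the set of (finite) terms obtained by repeated application of the rule: if $x_1,\dots,x_{n_i}\in X$ and $a_1,\dots,a_{m_i}\in TX$, then $\mathsf{C}_i\,x_1\ldots x_{n_i}\,a_1\ldots a_{m_i}\in TX$, for each $i\in I$. Repetitions among the $x_j$ or the $a_j$ are allowed. For $a=\mathsf{C}_i\,x_1\ldots x_{n_i}\,a_1\ldots a_{m_i}$, put $\mathrm{iv}(a)=\{x_1,\dots,x_{n_i}\}$ (immediate values) and $\mathrm{sp}(a)=\{a_1,\dots,a_{m_i}\}$ (sub-problems). The extension map is defined inductively by $[\![a]\!]=\mathrm{iv}(a)\cup\bigcup_{b\in \mathrm{sp}(a)}[\![b]\!]$. A $T$-representation map is a map $r\colon 2^X\to TX$ with $[\![r(A)]\!]=A$ for all $A\in 2^X$. A subset $\mathcal V\subseteq TX$ is expressive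 if for every $A\in 2^X$ there exists $a\in\mathcal V$ with $[\![a]\!]=A$. $\mathcal V$ is $T$-closed if, for each $i\in I$, whenever $\{a_1,\dots,a_{m_i}\}\subseteq\mathcal V$ then $\mathsf{C}_i\,x_1\ldots x_{n_i}\,a_1\ldots a_{m_i}\in\mathcal V$ for any $\{x_1,\dots,x_{n_i}\}\subseteq X$. Decision procedures. A decision procedure is a function $P\colon TX\to X$ with $P(a)\in[\![a]\!]$ for all $a\in TX$. - $P$ is $\mathcal V$-EXT if for all $a,b\in\mathcal V$, $[\![a]\!]=[\![b]\!]$ implies $P(a)=P(b)$. - $P$ is $\mathcal V$-IND if for all $a\in\mathcal V$, either $P(a)\in\mathrm{iv}(a)$ or there exists $b\in\mathrm{sp}(a)$ with $P(a)=P(b)$. Rationalizability. A strict preference relation $(X,\succ)$ is a complete, transitive, anti-symmetric relation on $X$; for $A\in 2^X$, $\max_\succ A$ is the unique $x\in A$ with $x\succ y$ for all $y\in A$, $y\ne x$. $P$ is $\mathcal V$-rationalizable if there is a strict preference relation $(X,\succ)$ such that $P(a)=\max_\succ[\![a]\!]$ for all $a\in\mathcal V$.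
   Formalization: For finite X with at least three alternatives, it is also assumed that some constructor has n_i>0 and m_i>0, or m_i>1; otherwise the claim fails, e.g. X={1,2,3}, T={<C,3,0>}, V=TX, P cyclic on pairs. *)

(* Defs.v *)
From mathcomp Require Import all_boot.
From mathcomp Require Import boolp classical_sets functions cardinality.

Set Implicit Arguments.
Unset Strict Implicit.
Unset Printing Implicit Defensive.

Local Open Scope classical_set_scope.

Definition decision_problem (X : Type) : Type :=
  {A : set X | finite_set A /\ A !=set0}.

(* A finite set of triples with pairwise distinct names is a finite type of    *)
(* names together with two arity functions on it.                              *)
Record representation : Type := Representation {
  constr : finType;
  nval : constr -> nat;
  nsub : constr -> nat;
  has_base : exists i : constr, 0 < nval i /\ nsub i = 0 }.

Inductive term (T : representation) (X : Type) : Type :=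
  Con (i : constr T) of ('I_(nval i) -> X) & ('I_(nsub i) -> term T X).
Arguments Con {T X} i _ _.

Section Terms.
Context {T : representation} {X : Type}.
Implicit Types (a b : term T X) (V : set (term T X)) (P : term T X -> X).

Definition iv a : set X := let: Con i x _ := a in range x.

Definition sp a : set (term T X) := let: Con i _ s := a in range s.

Fixpoint ext a : set X :=
  let: Con i x s := a in range x `|` \bigcup_j ext (s j).

Lemma extE a : ext a = iv a `|` \bigcup_(b in sp a) ext b.
Proof. by case: a => i x s /=; rewrite bigcup_image. Qed.

Definition representation_map (r : decision_problem X -> term T X) : Prop :=
  forall A : decision_problem X, ext (r A) = sval A.

Definition expressive V : Prop :=
  forall A : decision_problem X, exists2 a, V a & ext a = sval A.

Definition T_closed V : Prop :=
  forall (i : constr T) (x : 'I_(nval i) -> X) (s : 'I_(nsub i) -> term T X),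
    range s `<=` V -> V (Con i x s).

Definition decision_procedure P : Prop := forall a, ext a (P a).

Definition EXT V P : Prop :=
  forall a b, V a -> V b -> ext a = ext b -> P a = P b.

Definition IND V P : Prop :=
  forall a, V a -> iv a (P a) \/ exists2 b, sp a b & P a = P b.

End Terms.

(* Completeness is required of every pair, including x = y; the diagonal plays *)
(* no role in [is_max].                                                        *)
Definition strict_preference (X : Type) (succ : X -> X -> Prop) : Prop :=
  [/\ forall x y, succ x y \/ succ y x,
      forall x y z, succ x y -> succ y z -> succ x z
    & forall x y, succ x y -> succ y x -> x = y].

Definition is_max (X : Type) (succ : X -> X -> Prop) (A : set X) (x : X) : Prop :=
  A x /\ forall y, A y -> y <> x -> succ x y.

Lemma is_max_unique (X : Type) (succ : X -> X -> Prop) (A : set X) (x y : X) :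
  strict_preference succ -> is_max succ A x -> is_max succ A y -> x = y.
Proof.
move=> [_ _ anti] [Ax mx] [Ay my]; have [//|xy] := pselect (x = y).
by apply: anti; [apply: mx => // /esym|apply: my].
Qed.

Definition rationalizable (T : representation) (X : Type)
    (V : set (term T X)) (P : term T X -> X) : Prop :=
  exists2 succ : X -> X -> Prop, strict_preference succ &
    forall a, V a -> is_max succ (ext a) (P a).

(* Some constructor properly enlarges a sub-problem: it adds an immediate      *)
(* value to one, or joins two.  When X is infinite, finiteness of T and the    *)
(* existence of a representation map force this.  When X is finite with at     *)
(* least three elements they do not, and EXT and IND need not imply            *)
(* rationalizability without it: with X = {1,2,3} and the single constructor   *)
(* <C,3,0>, every choice function on the non-empty subsets of X is EXT and IND *)
(* on all of TX, because the immediate values are the whole extension.         *)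
Definition combining (T : representation) : Prop :=
  exists i : constr T, (0 < nval i /\ 0 < nsub i) \/ 1 < nsub i.

(* Main.v *)
(** By expressivity and EXT, [P] restricted to [V] is a choice function on the
finite non-empty sets.  A combining constructor builds from [b] in [V] and an
alternative [c] a term of [V] with extension [ext b] together with [c], on which
IND forces [P] to choose [P b] or [c].  Adding alternatives one at a time, a
choice from a large set that lies in a smaller one is the choice from the
smaller one (contraction consistency), and such choice functions are
rationalized by their values on pairs.  If no constructor is combining, the
extension of a term is at most as large as the immediate values of one
constructor, so expressivity bounds the size of [X]. *)
Require Import Defs.
From mathcomp Require Import all_boot finmap.
From mathcomp Require Import boolp classical_sets functions cardinality.

Local Open Scope classical_set_scope.
Local Open Scope card_scope.

Set Implicit Arguments.
Unset Strict Implicit.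

Lemma finite_set_ind (X : Type) (Q : set X -> Prop) :
  Q set0 -> (forall x A, Q A -> Q (x |` A)) -> forall A, finite_set A -> Q A.
Proof.
move=> Q0 QU A finA.
have /(@finite_seqP {classic X})[s ->] : @finite_set {classic X} A by [].
elim: s => [|x s IHs]; first by rewrite set_nil.
have -> : [set` x :: s] = x |` [set` s].
  by apply/seteqP; split=> y /=; rewrite in_cons => /predU1P.
exact: QU.
Qed.

Lemma finite_ext (T : representation) (X : Type) (a : term T X) :
  finite_set (ext a).
Proof.
elim: a => i x s IHs /=; rewrite finite_setU; split.
  exact/finite_image/finite_finset.
by apply: bigcup_finite => //; exact: finite_finset.
Qed.

Lemma card_range_ord (X : Type) (n : nat) (x : 'I_n -> X) : range x #<= `I_n.
Proof.
apply: card_le_trans; first exact: card_image_le.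
by have := @card_II n; rewrite card_eq_le => /andP[].
Qed.

(** Without a combining constructor, a node with a sub-problem has exactly one and no immediate
    values, so every term is a chain of wrappers around a single leaf. *)
Lemma card_ext_noncombining (T : representation) (X : Type) (a : term T X) :
  ~ combining T -> ext a #<= `I_(\max_(i : constr T) nval i).
Proof.
move=> ncT; elim: a => i x s IHs.
have [j0|nos] := pselect (exists j : 'I_(nsub i), True); last first.
  have -> : ext (Con i x s) = range x.
    apply/seteqP; split=> y /=; last by left.
    by move=> [//|[j]]; case: nos; exists j.
  apply: (card_le_trans (card_range_ord x)).
  by rewrite card_le_II leq_bigmax.
have [j _] := j0.
apply: (card_le_trans (subset_card_le _) (IHs j)) => y /= [[k _ _]|[k _]].
  case: ncT; exists i; left.
  by rewrite (leq_ltn_trans _ (ltn_ord k)) ?(leq_ltn_trans _ (ltn_ord j)).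
suff -> : k = j by [].
apply/val_inj/eqP/negPn/negP => /eqP kj; apply: ncT; exists i; right.
move: kj; case: (nsub i) j {j0 IHs} k => [|[|n]] j k //;
  by case: j k => [[|j] hj] [[|k] hk].
Qed.

Section Choice.
Context {T : representation} {X : Type}.
Context {V : set (term T X)} {P : term T X -> X}.
Hypothesis (hP : decision_procedure P).

Lemma expressive_finite (hV : expressive V) (A : set X) :
  finite_set A -> A !=set0 -> exists2 a, V a & ext a = A.
Proof. by move=> finA A0; exact: (hV (exist _ A (conj finA A0))). Qed.

Lemma expressive_combining (hV : expressive V) :
  infinite_set [set: X] -> combining T.
Proof.
move=> infX; apply: contrapT => ncT.
set N := \max_(i : constr T) nval i.
(* More than [N] elements: too many for the extension of any term. *)
have [B _ NB] := @infinite_set_fset {classic X} _ N.+1 infX.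
have [||a _ aE] := expressive_finite hV (A := [set` B]).
- exact: (@finite_fset {classic X}).
- have /fset0Pn[x xB] : B != fset0 by rewrite -cardfs_gt0 (leq_trans _ NB).
  by exists x.
have /(@geq_card_fset_set {classic X}) := card_ext_noncombining a ncT.
by rewrite aE set_fsetK leqNgt NB.
Qed.

Hypotheses (hV : expressive V) (hEXT : EXT V P).

Lemma combining_step (hVT : T_closed V) (hIND : IND V P)
    (b : term T X) (c : X) :
  combining T -> V b ->
  exists a, [/\ V a, ext a = c |` ext b & P a = P b \/ P a = c].
Proof.
move=> [i ci] Vb.
have [|a1 Va1 a1E] := expressive_finite hV (finite_set1 c).
  by exists c.
have Pa1 : P a1 = c by have := hP a1; rewrite a1E.
have i0 : 0 < nsub i by case: ci => [[]//|/ltnW].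
(* Slot 0 holds [b]; all other slots and all immediate values contribute only [c]. Either kind of
   combining constructor makes [c] occur at least once. *)
pose s (j : 'I_(nsub i)) := if val j == 0 then b else a1.
have Va : V (Con i (fun=> c) s).
  by apply: hVT => _ [j _ <-]; rewrite /s; case: ifP.
exists (Con i (fun=> c) s); split => //.
  apply/seteqP; split => y /=.
    move=> [[_ _ <-]|[j _]]; first by left.
    by rewrite /s; case: ifP => _; [right|rewrite a1E; left].
  move=> [->|yb]; last by right; exists (Ordinal i0).
  case: ci => [[n0 _]|m1]; first by left; exists (Ordinal n0).
  by right; exists (Ordinal m1); rewrite //= a1E.
case: (hIND _ Va) => [[_ _ <-]|[_ [j _ <-]] ->]; first by right.
by rewrite /s; case: ifP => _; [left|right].
Qed.

Definition contraction_consistent : Prop :=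
  forall a b, V a -> V b -> ext b `<=` ext a -> ext b (P a) -> P a = P b.

Lemma combining_contraction (hVT : T_closed V) (hIND : IND V P) :
  combining T -> contraction_consistent.
Proof.
move=> cT a b Va Vb sba.
(* Grow [ext b] to [ext a] [|] [ext b] one alternative at a time. Those already in [ext b] are
   skipped: adding one again could move the choice within [ext b]. A new one, if chosen, lies
   outside [ext b]. *)
have [a' [Va' a'E Pa']] : exists a', [/\ V a', ext a' = ext a `|` ext b
    & ext b (P a') -> P a' = P b].
  elim/finite_set_ind: (finite_ext a) => [|x A [a' [Va' a'E Pa']]].
    by exists b; rewrite set0U.
  have [bx|nbx] := pselect (ext b x).
    exists a'; split => //; rewrite a'E; apply/seteqP; split => y /=.
      by move=> [Ay|]; [left; right|right].
    by move=> [[->|]|]; [right|left|right].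
  have [c [Vc cE Pc]] := combining_step hVT hIND x cT Va'.
  exists c; split => //; first by rewrite cE a'E setUA.
  by case: Pc => ->.
suff -> : P a = P a' by exact: Pa'.
by apply: hEXT => //; rewrite a'E; exact/esym/setUidPl.
Qed.

(** Two distinct choices [P a] and [P b] in [ext b] exhaust [X], so [ext a] and [ext b] coincide,
    against EXT. *)
Lemma small_contraction : [set: X] #<= `I_2 -> contraction_consistent.
Proof.
move=> X2 a b Va Vb sba bPa; apply: contrapT => nab.
suff bT : forall y, ext b y.
  by apply: nab; apply: hEXT => //; apply/seteqP; split => // y _.
move=> y; apply: contrapT => nby.
have /pcard_leP[f] := X2.
have inj3 u v : u <> v -> f u <> f v.
  by move=> uv fuv; apply: uv; apply: 'inj_f; rewrite ?inE.
have f2 u : f u < 2 by exact: 'funS_f.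
have ne u v : ext b u -> v = y -> u <> v.
  by move=> bu -> uy; apply: nby; rewrite -uy.
have := inj3 _ _ nab; have := inj3 _ _ (ne _ _ bPa erefl).
have := inj3 _ _ (ne _ _ (hP b) erefl).
move: (f2 (P a)) (f2 (P b)) (f2 y).
by case: (f (P a)) (f (P b)) (f y) => [|[|//]] [|[|//]] [|[|//]].
Qed.

Lemma contraction_rationalizable : contraction_consistent -> rationalizable V P.
Proof.
move=> cc.
(* Preference revealed on pairs; for [x = y] the pair is a singleton, which gives reflexivity. *)
pose succ x y := exists2 a, V a /\ ext a = [set x; y] & P a = x.
have pairE x y : exists2 a, V a & ext a = [set x; y].
  by apply: (expressive_finite hV); [exact: finite_set2|exists x; left].
have succP a x y : V a -> P a = x -> ext a y -> succ x y.
  move=> Va Pax ay; have [b Vb bE] := pairE x y; exists b => //.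
  by rewrite -(cc a b) // bE ?Pax; [move=> z [->|->] //; rewrite -Pax|left].
exists succ; last by move=> a Va; split=> // y ay _; exact: succP ay.
split=> [x y|x y z|x y].
- have [a Va aE] := pairE x y.
  have := hP a; rewrite aE => -[Pa|Pa]; [left|right]; apply: (succP a) => //.
    by rewrite aE; right.
  by rewrite aE; left.
- move=> [b [Vb bE] Pb] [c [Vc cE] Pc].
  (* Transitivity: the choice from the triple is [x]. If it is [y], contraction to [[set x; y]]
     gives [y = x]; if it is [z], contraction to [[set y; z]] gives [z = y], the previous case. *)
  have [||a Va aE] := expressive_finite hV (A := [set x; y; z]).
  + by rewrite finite_setU; split; [exact: finite_set2|exact: finite_set1].
  + by exists x; left; left.
  apply: (succP a) => //; last by rewrite aE; right.
  have := hP a; rewrite aE => -[[//|Pay]|Paz].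
    rewrite -Pb -(cc a b) //; first by rewrite aE bE => t; left.
    by rewrite Pay bE; right.
  have zy : z = y.
    rewrite -Pc -(cc a c) //; last by rewrite Paz cE; right.
    by rewrite aE cE => t [->|->]; [left; right|right].
  rewrite -Pb -(cc a b) //; first by rewrite aE bE => t; left.
  by rewrite Paz zy bE; right.
- move=> [b [Vb bE] Pb] [c [Vc cE] Pc]; rewrite -Pb -Pc; apply: hEXT => //.
  by rewrite bE cE setUC.
Qed.

End Choice.

Unset Implicit Arguments.
Set Strict Implicit.

Theorem theorem6p5 (X : Type) (T : representation)
    (hr : exists r : decision_problem X -> term T X, representation_map r)
    (hX : finite_set [set: X] -> [set: X] #<= `I_2 \/ combining T)
    (V : set (term T X)) (hV : expressive V) (hVT : T_closed V)
    (P : term T X -> X) (hP : decision_procedure P)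
    (hEXT : EXT V P) (hIND : IND V P) :
  rationalizable V P.
Proof.
apply: contraction_rationalizable => //.
have [X2|cT] : [set: X] #<= `I_2 \/ combining T.
- have [/hX//|infX] := pselect (finite_set [set: X]).
  by right; exact: expressive_combining infX.
- exact: small_contraction.
- exact: combining_contraction.
Qed.
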